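(* Consider in the Heisenberg group $\mathbb H^n$, for $\epsilon>0$, the left-invariant Riemannian metric tensor $(g^\epsilon_{ij})_{i,j=1,\dots,2n+1}$ with respect to which $\{X_1,\dots,X_{2n},\sqrt\epsilon\,T\}$ is an orthonormal frame. Let $\mathcal S\subset\mathbb H^n$ be a $C^2$ hypersurface with $\Sigma_{\mathcal S}=\varnothing$, and let $\sigma^\epsilon$ be the surface area on $\mathcal S$ corresponding to the first fundamental form of the Riemannian metric induced on $\mathcal S$ by $(g^\epsilon_{ij})$. Then for any bounded open chart $U\subset\mathcal S$, $$\sigma_H(U)=\lim_{\epsilon\to0}\frac{\sigma^\epsilon(U)}{\sqrt{\det(g^\epsilon_{ij})}} .$$
   Context: $\mathbb H^n=\mathbb R^{2n+1}$ with points $(x,y,t)$, group law $(x,y,t)(x',y',t')=(x+x',y+y',t+t'+\frac12(\langle x,y'\rangle-\langle x',y\rangle))$, left-invariant fields $X_i=\partial_{x_i}-\frac{y_i}2\partial_t$, $X_{n+i}=\partial_{y_i}+\frac{x_i}2\partial_t$ ($1\le i\le n$), $T=\partial_t$. The tensor $(g^\epsilon_{ij})$ is expressed in the coordinates $(x,y,t)$, and $\langle\cdot,\cdot\rangle=g^1$ on tangent vectors. With $\boldsymbol N$ a non-unit $g^1$-normal to $\mathcal S$, $W=(\sum_{i\le2n}\langle\boldsymbol N,X_i\rangle^2)^{1/2}$; $\Sigma_{\mathcal S}=\{W=0\}$ is the characteristic set; the $H$-perimeter measure on $\mathcal S$ is $d\sigma_H=\frac{W}{|\boldsymbol N|}d\sigma$,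 where $\sigma$ is the surface measure on $\mathcal S$ for $g^1$. A chart $U\subset\mathcal S$ is an open coordinate patch, represented by a $C^2$ parametrization $\theta:\Omega\to U$ with $\Omega\subset\mathbb R^{2n}$ a bounded open set.
   Formalization: The chart U is additionally assumed to have finite surface area for g^1; without this the equality can fail, e.g. for infinitely many punctured disks {0<r<k^{-1/2}, t=1/k} in H^1, where the H-perimeter is finite but every σ^ε(U) is infinite. *)

(* Defs.v *)
From HB Require Import structures.
From mathcomp Require Import all_boot all_order all_algebra.
From mathcomp Require Import all_classical all_reals all_analysis.

Set Implicit Arguments.
Unset Strict Implicit.
Unset Printing Implicit Defensive.

From mathcomp Require Import ring.

Import Order.TTheory GRing.Theory Num.Theory.
Import numFieldNormedType.Exports.

Local Open Scope classical_set_scope.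
Local Open Scope ring_scope.

Section LebesgueMeasure.
Context (R : realType).

Notation tupleR m := (m.-tuple (measurableTypeR R)).

Definition consT m (z : measurableTypeR R * tupleR m) : tupleR m.+1 :=
  [tuple of z.1 :: z.2].

Lemma measurable_consT m : measurable_fun setT (@consT m).
Proof. exact: (measurable_cons measurable_fst measurable_snd). Qed.

Section cons_measure.
Variables (m : nat) (mu : {sigma_finite_measure set (tupleR m) -> \bar R}).

Definition cons_measure : set (tupleR m.+1) -> \bar R :=
  pushforward (@lebesgue_measure R \x mu)%E (@consT m).

Let cons_measure0 : cons_measure set0 = 0%E.
Proof. by rewrite /cons_measure /pushforward preimage_set0 measure0. Qed.

Let cons_measure_ge0 A : (0 <= cons_measure A)%E.
Proof. by rewrite /cons_measure /pushforward; exact: measure_ge0. Qed.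

Let cons_measure_sigma_additive : semi_sigma_additive cons_measure.
Proof.
move=> F mF tF mUF; rewrite /cons_measure /pushforward preimage_bigcup.
have mcons A : measurable A -> measurable (@consT m @^-1` A).
  by move=> mA; rewrite -[X in measurable X]setTI; exact: measurable_consT.
apply: measure_semi_sigma_additive.
- by move=> i; exact: mcons.
- apply/trivIsetP => /= i j _ _ ij; rewrite -preimage_setI.
  by move/trivIsetP : tF => /(_ _ _ _ _ ij) ->//; rewrite preimage_set0.
- by rewrite -preimage_bigcup; exact: mcons.
Qed.

HB.instance Definition _ := isMeasure.Build _ _ _ cons_measure
  cons_measure0 cons_measure_ge0 cons_measure_sigma_additive.

Let cons_measure_sigma_finite : sigma_finite setT cons_measure.
Proof.
have /sigma_finiteP[F [TF ndF Foo]] := sigma_finiteT (@lebesgue_measure R).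
have /sigma_finiteP[G [TG ndG Goo]] := sigma_finiteT mu.
exists (fun i => (fun t : tupleR m.+1 => F i (thead t)) `&`
                 (fun t : tupleR m.+1 => G i [tuple of behead t])).
  apply/seteqP; split => // t _.
  have [i _ Fi] : (\bigcup_i F i) (thead t) by rewrite -TF.
  have [j _ Gj] : (\bigcup_i G i) [tuple of behead t] by rewrite -TG.
  exists (maxn i j) => //; split.
  - by move: Fi; exact/subsetPset/ndF/leq_maxl.
  - by move: Gj; exact/subsetPset/ndG/leq_maxr.
move=> i; have [mF Fi] := Foo i; have [mG Gi] := Goo i; split.
  apply: measurableI.
    by have := @measurable_tnth _ (measurableTypeR R) m.+1 ord0 measurableT
      _ mF; rewrite setTI.
  by have := @measurable_behead _ (measurableTypeR R) m measurableT _ mG;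
    rewrite setTI.
rewrite /cons_measure /pushforward.
rewrite (_ : _ @^-1` _ = F i `*` G i); last first.
  apply/seteqP; split => -[a t] /= -[Fa Gt]; split => //.
    by move: Gt; rewrite (_ : [tuple of _] = t)//; exact: val_inj.
  by rewrite (_ : [tuple of _] = t)//; exact: val_inj.
by rewrite product_measure1E// lte_mul_pinfty// ge0_fin_numE.
Qed.

HB.instance Definition _ := Measure_isSigmaFinite.Build _ _ _ cons_measure
  cons_measure_sigma_finite.

End cons_measure.

(* Lebesgue measure on R^m, for the product sigma-algebra on m-tuples: the m-fold
   product of the Lebesgue measure on R *)
Fixpoint lebesgue_measureT m : {sigma_finite_measure set (tupleR m) -> \bar R} :=
  match m with
  | 0 => \d_([tuple] : tupleR 0)
  | m'.+1 => cons_measure (lebesgue_measureT m')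
  end.

Lemma lebesgue_measureT_box m (A : 'I_m -> set (measurableTypeR R)) :
  (forall i, measurable (A i)) ->
  lebesgue_measureT m [set t | forall i, A i (tnth t i)] =
  (\prod_(i < m) lebesgue_measure (A i))%E.
Proof.
elim: m A => [|m IHm] A mA /=.
  rewrite big_ord0 diracE mem_set//; by case.
rewrite big_ord_recl /cons_measure /pushforward.
rewrite (_ : _ @^-1` _ =
  A ord0 `*` [set t : tupleR m | forall i, A (lift ord0 i) (tnth t i)]).
  rewrite product_measure1E//; last first.
    rewrite (_ : [set _ | _] = \bigcap_(i in [set: 'I_m]) ((@tnth m (measurableTypeR R))^~ i @^-1` A (lift ord0 i))); last first.
      by apply/seteqP; split => t /= h i => [_|]; apply: h.
    apply: fin_bigcap_measurable => // i _.
    by rewrite -[X in measurable X]setTI; exact: measurable_tnth.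
  by congr (_ * _)%E; rewrite -IHm.
apply/seteqP; split => -[a t] /=.
  move=> h; split; first exact: (h ord0).
  by move=> i; have := h (lift ord0 i); rewrite tnthS.
by move=> [ha ht] i; case: (unliftP ord0 i) => [j ->|-> //]; rewrite tnthS.
Qed.

Definition rowT m (z : tupleR m) : 'rV[R]_m := \row_j tnth z j.

End LebesgueMeasure.
Arguments rowT {R m} z.

Section Ck.
Context (R : realType) (m : nat) (V : normedModType R).

(* F is C^k at every point of A; meant for open A *)
Fixpoint Ck (k : nat) (A : set 'rV[R]_m) (F : 'rV[R]_m -> V) : Prop :=
  (forall u, A u -> {for u, continuous F}) /\
  match k with
  | 0 => True
  | k'.+1 => forall i : 'I_m,
      (forall u, A u -> derivable F u (delta_mx 0 i)) /\
      Ck k' A (fun u => 'D_(delta_mx 0 i) F u)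
  end.

End Ck.

Section Heisenberg.
Context (R : realType) (n : nat).

(* the point (x, y, t) is the row vector of its 2n + 1 coordinates *)
Notation point := 'rV[R]_(n + n + 1).
Implicit Types (p q v w : point).

Definition xcoord p (i : 'I_n) : R := p 0 (lshift 1 (lshift n i)).
Definition ycoord p (i : 'I_n) : R := p 0 (lshift 1 (rshift n i)).

Definition Tfield : point := delta_mx 0 (rshift (n + n) 0).

Definition hmul p q : point :=
  p + q + (2^-1 * (\sum_(i < n) xcoord p i * ycoord q i
                   - \sum_(i < n) xcoord q i * ycoord p i)) *: Tfield.

(* X_1, ..., X_2n *)
Definition Xfield (k : 'I_(n + n)) p : point :=
  match fintype.split k with
  | inl i => delta_mx 0 (lshift 1 k) - (ycoord p i / 2) *: Tfield
  | inr i => delta_mx 0 (lshift 1 k) + (xcoord p i / 2) *: Tfield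
  end.

(* rows X_1, ..., X_2n, sqrt eps T *)
Definition frame (eps : R) p : 'M[R]_(n + n + 1) :=
  col_mx (\matrix_k Xfield k p) (Num.sqrt eps *: Tfield).

(* The matrix g of g^eps in the coordinates (x, y, t) is determined by
   E g E^T = 1, where E = frame eps p: see metric_frame. *)
Definition metric (eps : R) p : 'M[R]_(n + n + 1) :=
  invmx (frame eps p) *m (invmx (frame eps p))^T.

Definition gdot (eps : R) p v w : R := (v *m metric eps p *m w^T) 0 0.

Lemma frame_block eps p : frame eps p =
  block_mx 1%:M (\col_k Xfield k p 0 (rshift (n + n) 0))
           0 (Num.sqrt eps)%:M.
Proof.
rewrite /frame /block_mx; congr col_mx; apply/matrixP => i j;
  case: (split_ordP j) => j' ->;
  rewrite ?row_mxEl ?row_mxEr !mxE ?(ord1 j') ?(ord1 i) ?eqxx ?mulr1 //.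
  by rewrite /Xfield; case: fintype.splitP => i' _;
    rewrite !mxE eq_lrshift andbF mulr0 ?subr0 ?addr0 /= (inj_eq (@lshift_inj _ _))
      eq_sym.
by rewrite eq_lrshift andbF mulr0.
Qed.

Lemma frame_unit eps p : 0 < eps -> frame eps p \in unitmx.
Proof.
move=> eps0.
by rewrite unitmxE frame_block det_ublock det1 mul1r det_scalar1 unitfE
  sqrtr_eq0 -ltNge.
Qed.

Lemma metric_frame eps p : 0 < eps ->
  frame eps p *m metric eps p *m (frame eps p)^T = 1%:M.
Proof.
move=> eps0; have uE := frame_unit p eps0.
by rewrite /metric mulmxA mulmxV// mul1mx -trmx_mul mulmxV// trmx1.
Qed.

Lemma Tfield_left_invariant p q s :
  hmul p (q + s *: Tfield) = hmul p q + s *: Tfield.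
Proof.
rewrite /hmul.
have xT i : xcoord (q + s *: Tfield) i = xcoord q i.
  by rewrite /xcoord !mxE eq_lrshift andbF mulr0 addr0.
have yT i : ycoord (q + s *: Tfield) i = ycoord q i.
  by rewrite /ycoord !mxE eq_lrshift andbF mulr0 addr0.
under eq_bigr do rewrite yT.
under [X in _ - X]eq_bigr do rewrite xT.
by apply/rowP => j; rewrite !mxE; ring.
Qed.

Lemma Xfield_left_invariant k p q s :
  hmul p (q + s *: Xfield k q) = hmul p q + s *: Xfield k (hmul p q).
Proof.
have xM i : xcoord (hmul p q) i = xcoord p i + xcoord q i.
  by rewrite /xcoord !mxE eq_lrshift andbF mulr0 addr0.
have yM i : ycoord (hmul p q) i = ycoord p i + ycoord q i.
  by rewrite /ycoord !mxE eq_lrshift andbF mulr0 addr0.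
have xD i : xcoord (q + s *: Xfield k q) i
    = xcoord q i + s * (k == lshift n i)%:R.
  rewrite /xcoord /Xfield; case: fintype.splitP => ? _;
    by rewrite !mxE eq_lrshift andbF mulr0 ?subr0 ?addr0
      (inj_eq (@lshift_inj _ _)) eq_sym.
have yD i : ycoord (q + s *: Xfield k q) i
    = ycoord q i + s * (k == rshift n i)%:R.
  rewrite /ycoord /Xfield; case: fintype.splitP => ? _;
    by rewrite !mxE eq_lrshift andbF mulr0 ?subr0 ?addr0
      (inj_eq (@lshift_inj _ _)) eq_sym.
have sumE (F : 'I_n -> R) i0 : \sum_(i < n) F i * (i0 == i)%:R = F i0.
  rewrite (bigD1 i0)//= eqxx mulr1 big1 ?addr0// => i /negPf.
  by rewrite eq_sym => ->; rewrite mulr0.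
have -> : hmul p (q + s *: Xfield k q) = hmul p q + s *: Xfield k q +
    (s * (2^-1 * (\sum_(i < n) xcoord p i * (k == rshift n i)%:R
           - \sum_(i < n) ycoord p i * (k == lshift n i)%:R))) *: Tfield.
  rewrite /hmul.
  under eq_bigr do rewrite yD mulrDr.
  under [X in _ - X]eq_bigr do rewrite xD mulrDl.
  rewrite !big_split /=.
  rewrite (_ : \sum_(i < n) xcoord p i * (s * _) =
    s * \sum_(i < n) xcoord p i * (k == rshift n i)%:R); last first.
    by rewrite mulr_sumr; apply: eq_bigr => i _; rewrite mulrCA.
  rewrite (_ : \sum_(i < n) s * _ * _ =
    s * \sum_(i < n) ycoord p i * (k == lshift n i)%:R); last first.
    rewrite mulr_sumr; apply: eq_bigr => i _.
    by rewrite -mulrA [in RHS](mulrC (ycoord p i)).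
  by apply/rowP => j; rewrite !mxE; ring.
rewrite -addrA; congr (_ + _); rewrite /Xfield.
case: split_ordP => i -> /=.
  under eq_bigr do rewrite eq_lrshift mulr0.
  under [X in 2^-1 * (_ - X)]eq_bigr do rewrite (inj_eq (@lshift_inj _ _)).
  rewrite big1// sumE yM; apply/rowP => j; rewrite !mxE; ring.
under eq_bigr do rewrite (inj_eq (@rshift_inj _ _)).
under [X in 2^-1 * (_ - X)]eq_bigr do rewrite eq_rlshift mulr0.
rewrite [X in _ - X]big1 ?sumE ?xM; last by [].
by apply/rowP => j; rewrite !mxE; ring.
Qed.

(* velocities at p of curves in S *)
Definition tangent (S : set point) p v : Prop :=
  exists gamma : R -> point, [/\ gamma 0 = p,
    (\forall s \near (0 : R), S (gamma s)) & is_derive (0 : R) 1 gamma v].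

(* S is locally a level set of a C^2 function without critical points *)
Definition C2_hypersurface (S : set point) : Prop :=
  forall p, S p -> exists (V : set point) (f : point -> R),
    [/\ open V, V p, Ck 2 V f,
        (forall q, V q -> exists i, 'D_(delta_mx 0 i) f q != 0) &
        S `&` V = [set q | V q /\ f q = 0]].

(* N is only a choice of a nonzero g^1-normal vector at each point of S; no
   continuity or orientability is required, since only quantities invariant under
   rescaling of N are used. *)
Definition normal_field (S : set point) (N : point -> point) : Prop :=
  forall p, S p -> N p != 0 /\ (forall v, tangent S p v -> gdot 1 p (N p) v = 0).

Definition horizontal_norm (N : point -> point) p : R :=
  Num.sqrt (\sum_(k < n + n) gdot 1 p (N p) (Xfield k p) ^+ 2).

Definition characteristic_set (S : set point) (N : point -> point) : set point :=
  [set p | S p /\ horizontal_norm N p = 0].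

Definition tangent_mx (theta : 'rV[R]_(n + n) -> point) u :
    'M[R]_(n + n, n + n + 1) :=
  \matrix_j 'D_(delta_mx 0 j) theta u.

(* The rank of theta is full and theta is open as a map into S, so U is open in
   S and theta is a homeomorphism from Omega onto U. *)
Record chart (S U : set point) (Omega : set 'rV[R]_(n + n))
    (theta : 'rV[R]_(n + n) -> point) : Prop := Chart {
  chart_open : open Omega;
  chart_bounded : bounded_set Omega;
  chart_image : theta @` Omega = U;
  chart_sub : U `<=` S;
  chart_inj : {in Omega &, injective theta};
  chart_C2 : Ck 2 Omega theta;
  chart_immersion : forall u, Omega u -> row_free (tangent_mx theta u);
  chart_open_map : forall O, open O -> O `<=` Omega ->
    exists2 V, open V & theta @` O = S `&` V }.

Definition first_fundamental_form (eps : R) theta u : 'M[R]_(n + n) :=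
  tangent_mx theta u *m metric eps (theta u) *m (tangent_mx theta u)^T.

Local Open Scope ereal_scope.

(* integral of f over theta(Omega) for the surface measure induced by g^eps *)
Definition surface_integral (eps : R) (Omega : set 'rV[R]_(n + n)) theta
    (f : point -> R) : \bar R :=
  \int[lebesgue_measureT R (n + n)]_(z in rowT @^-1` Omega)
    (f (theta (rowT z)) *
     Num.sqrt (\det (first_fundamental_form eps theta (rowT z))))%:E.

Definition surface_area (eps : R) Omega theta : \bar R :=
  surface_integral eps Omega theta (fun=> 1%R).

Definition H_perimeter (N : point -> point) Omega theta : \bar R :=
  surface_integral 1 Omega theta
    (fun p => horizontal_norm N p / Num.sqrt (gdot 1 p (N p) (N p)))%R.

End Heisenberg.

(* Main.v *)
Require Import Defs.
From mathcomp Require Import all_boot all_order all_algebra.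
From mathcomp Require Import all_classical all_reals all_analysis.
From mathcomp Require Import measurable_realfun.

Set Implicit Arguments.
Unset Strict Implicit.
Unset Printing Implicit Defensive.

Import Order.TTheory GRing.Theory Num.Theory.
Import numFieldNormedType.Exports.

Local Open Scope classical_set_scope.
Local Open Scope ring_scope.

(* Write the tangent matrix of the chart as [row_mx A b] and let [w] be the
   contact form applied to its rows. In the orthonormal frame of [g^eps] the
   tangent vectors have the coordinates [row_mx A (w / sqrt eps)], so the rank-one
   update formula for determinants gives
     [eps * det (first_fundamental_form eps) = eps * d^2 + |z|^2]
   with [d = det A] and [z = adj A * w], while [det g^eps = 1 / eps]. Hence the
   scaled area density lies between [|z|] and [|z| + sqrt eps * |d|], where [|d|] is
   at most the area density for [eps = 1], which has a finite integral. Finally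
   [|z|] is the density of the H-perimeter, since the frame coordinates of a
   normal vector are proportional to [(z, - d)]. *)

(** * Determinants and adjugates under rank-one updates *)

(** The bordered matrix [K] has Schur complement [M + w *m v], and a factor of determinant [\det M]
    clears its upper right block. That factor cannot be cancelled yet, since [M] may be singular. *)
Lemma mul_det_addmx_rank1 (R : comNzRingType) n (M : 'M[R]_n) (w : 'cV_n)
    (v : 'rV_n) :
  \det M * \det (M + w *m v) = \det M * (\det M + (v *m \adj M *m w) 0 0).
Proof.
pose K := block_mx M w (- v) (1%:M : 'M[R]_1).
have detK : \det K = \det (M + w *m v).
  have -> : K = block_mx 1%:M w 0 1%:M *m block_mx (M + w *m v) 0 (- v) 1%:M.
    by rewrite mulmx_block !mul1mx !mul0mx mulmx1 mulmxN addrK !add0r.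
  by rewrite det_mulmx det_ublock det_lblock !det1 !mulr1 mul1r.
have : K *m block_mx 1%:M (- (\adj M *m w)) 0 (\det M)%:M =
    block_mx M 0 (- v) (v *m \adj M *m w + (\det M)%:M).
  rewrite mulmx_block !mulmx1 !mulmx0 !addr0 mul1mx mulmxN mulNmx mulmxN opprK.
  by rewrite !mulmxA mul_mx_adj mul_mx_scalar mul_scalar_mx addNr.
move/(congr1 determinant); rewrite det_mulmx detK det_ublock det_lblock det1.
rewrite mul1r det_scalar1 det_mx11 !mxE eqxx mulr1n mulrC => ->.
by rewrite [in RHS]addrC.
Qed.

Lemma det_char_poly_mx_neq0 (R : idomainType) n (M : 'M[R]_n) :
  \det (char_poly_mx M) != 0.
Proof. exact/monic_neq0/char_poly_monic. Qed.

Lemma char_poly_mx_at0 (R : comNzRingType) n (M : 'M[R]_n) :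
  map_mx (horner_eval 0) (char_poly_mx (- M)) = M.
Proof.
apply/matrixP => i j; rewrite /char_poly_mx !mxE /horner_eval.
by rewrite !hornerE hornerMn hornerX mul0rn add0r opprK.
Qed.

Lemma map_polyC_at0 (R : comNzRingType) p q (B : 'M[R]_(p, q)) :
  map_mx (horner_eval 0) (map_mx polyC B) = B.
Proof. by apply/matrixP => i j; rewrite !mxE /horner_eval hornerC. Qed.

(* The matrix [char_poly_mx (- M)] is [M + 'X]: its determinant is nonzero, hence
   can be cancelled before specializing at ['X = 0]. *)
Lemma det_addmx_rank1 (R : idomainType) n (M : 'M[R]_n) (w : 'cV_n)
    (v : 'rV_n) :
  \det (M + w *m v) = \det M + (v *m \adj M *m w) 0 0.
Proof.
have := mul_det_addmx_rank1 (char_poly_mx (- M)) (map_mx polyC w)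
  (map_mx polyC v).
move/(mulfI (det_char_poly_mx_neq0 _))/(congr1 (horner_eval 0)).
have ev00 (B : 'M[{poly R}]_1) :
    horner_eval 0 (B 0 0) = (map_mx (horner_eval 0) B) 0 0 by rewrite mxE.
rewrite rmorphD /= ev00 -!det_map_mx map_mxD !map_mxM map_mx_adj.
by rewrite !map_polyC_at0 char_poly_mx_at0.
Qed.

Lemma adj_mulmx (R : idomainType) n (A B : 'M[R]_n) :
  \adj (A *m B) = \adj B *m \adj A.
Proof.
(* The identity for ['X + A] and ['X + B], whose determinants are nonzero, specializes at ['X = 0].
   This changes the ring, so [R] is generalized too. *)
wlog dAB : R A B / \det (A *m B) != 0.
  move=> H; have := H _ (char_poly_mx (- A)) (char_poly_mx (- B)).
  rewrite det_mulmx mulf_neq0 ?det_char_poly_mx_neq0// => /(_ isT).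
  move/(congr1 (map_mx (horner_eval 0))).
  by rewrite map_mx_adj !map_mxM !map_mx_adj !char_poly_mx_at0.
(* Contracting [\adj A *m A], then [\adj B *m B], turns the left side into
   [\det (A *m B) *: \adj (A *m B)]. *)
have : \adj B *m \adj A *m (A *m B) *m \adj (A *m B) =
    \det (A *m B) *: (\adj B *m \adj A).
  by rewrite -mulmxA mul_mx_adj mul_mx_scalar.
rewrite !mulmxA -[_ *m _ *m A]mulmxA mul_adj_mx mul_mx_scalar -scalemxAl.
rewrite mul_adj_mx scale_scalar_mx -det_mulmx mul_scalar_mx.
move/matrixP => E; apply/matrixP => i j.
by have := E i j; rewrite mxE [RHS]mxE => /(mulfI dAB).
Qed.

(** The adjugate of [A *m A^T] is [(\adj A)^T *m \adj A], so the quadratic form in the rank-one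
    update is a sum of squares. *)
Lemma det_mulmx_tr_add_rank1 (R : idomainType) n (A : 'M[R]_n) (w : 'cV_n)
    (k : R) :
  \det (A *m A^T + k *: (w *m w^T)) =
  \det A ^+ 2 + k * (\sum_i (\adj A *m w) i 0 ^+ 2).
Proof.
rewrite scalemxAr [LHS]det_addmx_rank1 det_mulmx det_tr -expr2; congr (_ + _).
rewrite adj_mulmx -trmx_adj -!scalemxAl mxE; congr (_ * _).
rewrite mulmxA -trmx_mul -mulmxA mxE.
by apply: eq_bigr => i _; rewrite mxE expr2.
Qed.

(** * Frame coordinates, Gram determinants and normal vectors *)

Section Frame.
Context (R : realType) (n : nat).
Notation point := 'rV[R]_(n + n + 1).
Implicit Types (p v : point) (eps : R).

Definition vertical p : 'cV[R]_(n + n) :=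
  \col_k Xfield k p 0 (rshift (n + n) 0).

(* the contact form [dt + (<y, dx> - <x, dy>) / 2], applied to each row of [J] *)
Definition contact p k (J : 'M[R]_(k, n + n + 1)) : 'cV[R]_k :=
  rsubmx J - lsubmx J *m vertical p.

Lemma invmx_frame eps p : 0 < eps ->
  invmx (frame eps p) =
  block_mx 1%:M (- (Num.sqrt eps)^-1 *: vertical p) 0 ((Num.sqrt eps)^-1)%:M.
Proof.
move=> eps0; have s0 : Num.sqrt eps != 0 by rewrite gt_eqF// sqrtr_gt0.
apply: (can_inj (mulKmx (frame_unit p eps0))).
rewrite mulmxV ?frame_unit// frame_block mulmx_block.
rewrite !mul1mx !mulmx0 !mul0mx !addr0 !add0r mul_mx_scalar scaleNr addNr.
by rewrite -scalar_mxM divff// -scalar_mx_block.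
Qed.

(** These are the coordinates of the rows in the orthonormal frame; only the last one depends on
    [eps]. *)
Lemma mulmx_invmx_frame eps p k (J : 'M[R]_(k, n + n + 1)) : 0 < eps ->
  J *m invmx (frame eps p) =
  row_mx (lsubmx J) ((Num.sqrt eps)^-1 *: contact p J).
Proof.
move=> eps0; rewrite invmx_frame// -{1}(hsubmxK J) mul_row_block mulmx1 mulmx0.
rewrite addr0 mul_mx_scalar -scalemxAr /contact scalerBr scaleNr addrC.
by [].
Qed.

Lemma det_metric eps p : 0 < eps -> \det (metric eps p) = eps^-1.
Proof.
move=> eps0; rewrite /metric det_mulmx det_tr invmx_frame// det_ublock det1.
by rewrite det_scalar1 mul1r -expr2 exprVn sqr_sqrtr// ltW.
Qed.

Lemma det_gram eps p (J : 'M[R]_(n + n, n + n + 1)) : 0 < eps ->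
  \det (J *m metric eps p *m J^T) = \det (lsubmx J) ^+ 2 +
    eps^-1 * \sum_i (\adj (lsubmx J) *m contact p J) i 0 ^+ 2.
Proof.
move=> eps0; rewrite /metric mulmxA -mulmxA -trmx_mul mulmx_invmx_frame//.
rewrite tr_row_mx mul_row_col linearZ /= -scalemxAl -scalemxAr scalerA.
by rewrite -expr2 exprVn sqr_sqrtr ?ltW// det_mulmx_tr_add_rank1.
Qed.

Lemma gdotE p v w : gdot 1 p v w =
  ((v *m invmx (frame 1 p)) *m (w *m invmx (frame 1 p))^T) 0 0.
Proof. by rewrite /gdot /metric trmx_mul !mulmxA. Qed.

(** Coordinates in the [g^1]-orthonormal frame, where [gdot 1] becomes the Euclidean product. *)
Definition frame_coord p v : point := v *m invmx (frame 1 p).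

Lemma gdot_self p v : gdot 1 p v v =
  \sum_i frame_coord p v 0 (lshift 1 i) ^+ 2 +
  frame_coord p v 0 (rshift (n + n) 0) ^+ 2.
Proof.
rewrite gdotE -/(frame_coord p v) mxE big_split_ord /= big_ord1.
by rewrite !mxE expr2; congr (_ + _); apply: eq_bigr => i _; rewrite !mxE.
Qed.

Lemma gdot_self_gt0 p v : v != 0 -> 0 < gdot 1 p v v.
Proof.
move=> v0; rewrite gdotE -/(frame_coord p v) mxE.
have : frame_coord p v != 0.
  apply: contra_neq v0 => v0.
  rewrite -[v](mulmxKV (frame_unit p (@ltr01 R))) -/(frame_coord p v).
  by rewrite v0 mul0mx.
rewrite lt_def sumr_ge0 ?andbT => [|i _]; last first.
  by rewrite !mxE -expr2 sqr_ge0.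
apply: contra_neq => /eqP.
rewrite psumr_eq0 => [/allP h|i _]; last by rewrite [_^T _ _]mxE -expr2 sqr_ge0.
apply/rowP => j; have /= := h j; rewrite mem_index_enum => /(_ isT).
by rewrite [_^T _ _]mxE -expr2 sqrf_eq0 => /eqP ->; rewrite mxE.
Qed.

Lemma gdot_Xfield p v k :
  gdot 1 p v (Xfield k p) = frame_coord p v 0 (lshift 1 k).
Proof.
rewrite gdotE -/(frame_coord p v).
have -> : Xfield k p = row (lshift 1 k) (frame 1 p).
  by rewrite /frame rowKu rowK.
rewrite -row_mul mulmxV ?frame_unit// row1 mxE (bigD1 (lshift 1 k))//= big1.
  by rewrite !mxE !eqxx mulr1 addr0.
by move=> i /negPf ik; rewrite !mxE ik andbF mulr0.
Qed.

Lemma horizontal_normE (N : point -> point) p : horizontal_norm N p =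
  Num.sqrt (\sum_i frame_coord p (N p) 0 (lshift 1 i) ^+ 2).
Proof. by congr Num.sqrt; apply: eq_bigr => i _; rewrite gdot_Xfield. Qed.

(* Let [(h, t)] be the frame coordinates of a vector normal to the rows of [J],
   [d := det A] and [z := adj A * contact p J] with [A := lsubmx J]. Applying
   [adj A] to the normality relation gives [d h = - t z], so that
   [|h|^2 (d^2 + |z|^2) = (t^2 + |h|^2) |z|^2]. *)
Lemma horizontal_norm_det_gram (N : point -> point) p
    (J : 'M[R]_(n + n, n + n + 1)) :
  N p != 0 -> (forall k, gdot 1 p (N p) (row k J) = 0) ->
  horizontal_norm N p / Num.sqrt (gdot 1 p (N p) (N p)) *
    Num.sqrt (\det (J *m metric 1 p *m J^T)) =
  Num.sqrt (\sum_i (\adj (lsubmx J) *m contact p J) i 0 ^+ 2).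
Proof.
move=> Np0 NJ; have Np := gdot_self_gt0 p Np0.
rewrite horizontal_normE det_gram// invr1 mul1r.
move: Np; rewrite gdot_self.
set nu := frame_coord p (N p); set d := \det _; set z := \adj _ *m _.
set H := \sum_i nu 0 _ ^+ 2; set Z := \sum_i z i 0 ^+ 2.
set t := nu 0 (rshift _ _) => Np.
have normal : lsubmx J *m (lsubmx nu)^T = - t *: contact p J.
  (* Normality to all rows says that the frame coordinates of [J] annihilate those of [N p]. *)
  have /eqP : J *m invmx (frame 1 p) *m nu^T = 0.
    apply/colP => k; rewrite [RHS]mxE -(NJ k) gdotE -/(frame_coord p (N p)) -/nu.
    rewrite -row_mul mxE [RHS]mxE; apply: eq_bigr => i _.
    by rewrite ![_^T _ _]mxE [row _ _ _ _]mxE mulrC.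
  rewrite mulmx_invmx_frame// sqrtr1 invr1 scale1r -[nu]hsubmxK tr_row_mx.
  rewrite mul_row_col [rsubmx nu]mx11_scalar mxE -/t tr_scalar_mx mul_mx_scalar.
  by rewrite addr_eq0 -scaleNr row_mxKl => /eqP.
have dh : d *: (lsubmx nu)^T = - t *: z.
  by rewrite -mul_scalar_mx -mul_adj_mx -mulmxA normal -scalemxAr.
have HZ : d ^+ 2 * H = t ^+ 2 * Z.
  rewrite !mulr_sumr; apply: eq_bigr => i _.
  have /colP/(_ i) := dh; rewrite !mxE => dhi.
  by rewrite -!exprMn dhi mulNr sqrrN.
have H0 : 0 <= H by apply: sumr_ge0 => i _; exact: sqr_ge0.
have Z0 : 0 <= Z by apply: sumr_ge0 => i _; exact: sqr_ge0.
rewrite mulrAC -sqrtrM//; apply/(canLR (mulfK _)).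
  by rewrite gt_eqF// sqrtr_gt0.
rewrite -sqrtrM//; congr Num.sqrt.
by rewrite mulrDr mulrDr mulrC HZ mulrC addrC [H * Z]mulrC.
Qed.

End Frame.

(** * Open sets and continuous functions in tuple coordinates *)

Section MeasurableCoordinates.
Context (R : realType) (m : nat).
Notation tupleR := (m.-tuple (measurableTypeR R)).

(* an open set is a countable union of rational cubes *)
Lemma measurable_preimage_rowT (V : set 'rV[R]_m) : open V ->
  measurable (@rowT R m @^-1` V : set tupleR).
Proof.
move=> oV.
pose cube (qk : m.-tuple rat * nat) : set tupleR :=
  [set t | forall i, ball (ratr (tnth qk.1 i) : R) (qk.2.+1%:R^-1) (tnth t i)].
have mcube qk : measurable (cube qk).
  rewrite (_ : cube qk = \bigcap_(i in [set: 'I_m])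
      ((@tnth m (measurableTypeR R))^~ i @^-1` ball (ratr (tnth qk.1 i) : R) (qk.2.+1%:R^-1))); last first.
    by apply/seteqP; split => t /= h i => [_|]; apply: h.
  apply: fin_bigcap_measurable => // i _.
  rewrite -[X in measurable X]setTI; apply: measurable_tnth => //.
  by apply: open_measurable; exact: (@ball_open R R).
(* Cubes not inside the preimage are replaced by [set0], so that the union runs over a whole
   countable type. *)
rewrite (_ : _ @^-1` _ = \bigcup_qk
    (if `[< cube qk `<=` @rowT R m @^-1` V >] then cube qk else set0)).
  by apply: countable_bigcupT_measurable => [|qk]; [exact: countableP|case: ifP].
apply/seteqP; split => [t Vt|t [qk _]]; last first.
  by case: asboolP => // sub /sub.
have /nbhs_ballP[e /= e0 eV] : nbhs (rowT t) V by exact: open_nbhs_nbhs.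
(* The radius is then below [e / 2], so a cube containing [t] stays in the [e]-ball around
   [rowT t]. *)
pose k := Num.truncn (2 / e).
have ke : k.+1%:R^-1 < e / 2 :> R.
  rewrite -[e / 2]invf_div ltf_pV2 ?posrE ?divr_gt0//.
  exact: truncnS_gt.
have k0 : 0 < k.+1%:R^-1 :> R by rewrite invr_gt0.
have approx i : exists q : rat, ball (ratr q : R) (k.+1%:R^-1) (tnth t i).
  have [|r [tr [q _ qr]]] :=
    @dense_rat R (ball (tnth t i : R) (k.+1%:R^-1)) _ (ball_open _ _).
    by exists (tnth t i); exact: ballxx.
  by exists q; rewrite qr; exact: ball_sym.
have [q qt] := choice approx.
exists ([tuple q i | i < m], k) => //.
case: asboolP => [_|[]]; first by move=> i /=; rewrite tnth_mktuple.
move=> s cs; apply: eV; split => // i j; rewrite !mxE.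
rewrite [e]splitr; apply: (@ball_triangle R R (ratr (q j))).
  by apply: ball_sym; apply: (le_ball (ltW ke)).
by apply: (le_ball (ltW ke)); have := cs j; rewrite /= tnth_mktuple.
Qed.

(** Open intervals generate the Borel sets, and continuity at the points of [Omega] makes their
    preimages in [Omega] open. *)
Lemma measurable_fun_rowT (Omega : set 'rV[R]_m) (f : 'rV[R]_m -> R) :
  open Omega -> (forall u, Omega u -> {for u, continuous f}) ->
  measurable_fun (@rowT R m @^-1` Omega) (fun z : tupleR => f (rowT z)).
Proof.
move=> oO cf; apply: (measurability _ (RGenOpens.measurableE R)).
move=> _ [_ [a [b ->] <-]].
rewrite (_ : _ `&` _ = rowT @^-1` (Omega `&` f @^-1` `]a, b[))//.
apply: measurable_preimage_rowT; rewrite openE => u [Ou fu]; apply: filterI.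
  exact: open_nbhs_nbhs.
by apply: (cf u Ou); apply: open_nbhs_nbhs; split => //; exact: interval_open.
Qed.

End MeasurableCoordinates.

(** * Measurability of matrix operations *)

Section MeasurableMatrix.
Context d (T : measurableType d) (R : realType) (D : set T).

Lemma measurable_fun_det n (A : T -> 'M[R]_n) :
  (forall i j, measurable_fun D (fun x => A x i j)) ->
  measurable_fun D (fun x => \det (A x)).
Proof.
move=> mA; rewrite /determinant; apply: measurable_sum => s.
apply: measurable_funM; first exact: measurable_cst.
by apply: measurable_prod => i _; exact: mA.
Qed.

Lemma measurable_fun_mulmx p q r (A : T -> 'M[R]_(p, q)) (B : T -> 'M[R]_(q, r)) :
  (forall i j, measurable_fun D (fun x => A x i j)) ->
  (forall i j, measurable_fun D (fun x => B x i j)) ->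
  forall i j, measurable_fun D (fun x => (A x *m B x) i j).
Proof.
move=> mA mB i j; under eq_fun do rewrite mxE.
by apply: measurable_sum => k; apply: measurable_funM.
Qed.

Lemma measurable_fun_adj n (A : T -> 'M[R]_n) :
  (forall i j, measurable_fun D (fun x => A x i j)) ->
  forall i j, measurable_fun D (fun x => (\adj (A x)) i j).
Proof.
move=> mA i j; under eq_fun do rewrite mxE /cofactor.
apply: measurable_funM; first exact: measurable_cst.
apply: measurable_fun_det => k l; under eq_fun do rewrite !mxE.
exact: mA.
Qed.

Lemma measurable_fun_sqrt (f : T -> R) :
  measurable_fun D f -> measurable_fun D (fun x => Num.sqrt (f x)).
Proof.
apply: measurableT_comp; apply: continuous_measurable_fun.
exact: sqrt_continuous.
Qed.

End MeasurableMatrix.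

Lemma cvg_sqrt_affine (R : realType) (a b : R) :
  a + Num.sqrt eps * b @[eps --> 0^'+] --> a.
Proof.
have {2}-> : a = a + Num.sqrt 0 * b by rewrite sqrtr0 mul0r addr0.
apply: cvgD; [exact: cvg_cst|apply: cvgM; [|exact: cvg_cst]].
by apply: cvg_at_right_filter; exact: sqrt_continuous.
Qed.

(** * Area densities of a chart *)

Section ChartTheory.
Context (R : realType) (n : nat) (S U : set 'rV[R]_(n + n + 1)).
Context (Omega : set 'rV[R]_(n + n)) (theta : 'rV[R]_(n + n) -> 'rV[R]_(n + n + 1)).
Context (chart_U : chart S U Omega theta).
Notation D := (@rowT R (n + n) @^-1` Omega).

(** The curve is the image of a coordinate line through [u]; openness of [Omega] keeps it in [S] for
    small [s]. *)
Lemma chart_tangent u k : Omega u ->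
  tangent S (theta u) (row k (tangent_mx theta u)).
Proof.
move=> Ou; exists (fun s : R => theta (u + s *: delta_mx 0 k)); split.
- by rewrite scale0r addr0.
- have cu : {for (0 : R), continuous (fun s : R => u + s *: delta_mx 0 k)}.
    by apply: cvgD; [exact: cvg_cst|apply: cvgZl; exact: cvg_id].
  apply: (cu (fun v => S (theta v))); rewrite scale0r addr0.
  apply: (@filterS _ _ _ Omega) => [v Ov|].
    by apply: (chart_sub chart_U); rewrite -(chart_image chart_U); exists v.
  by apply: open_nbhs_nbhs; split => //; exact: (chart_open chart_U).
have [_ /(_ k)[/(_ u Ou) dtheta _]] := chart_C2 chart_U.
have E : (fun h : R => h^-1 *:
      (((fun s : R => theta (u + s *: delta_mx 0 k)) \o shift 0) (h *: (1 : R)) - theta (u + 0 *: delta_mx 0 k))) =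
    (fun h => h^-1 *: ((theta \o shift u) (h *: delta_mx 0 k) - theta u)).
  apply/funext => h /=.
  by rewrite scale0r !addr0 [_ *: 1]mulr1 [u + _]addrC.
apply: DeriveDef; first by rewrite /derivable E.
by rewrite /derive E rowK.
Qed.

Lemma measurable_chart_domain : measurable (D : set (_.-tuple (measurableTypeR R))).
Proof. by apply: measurable_preimage_rowT; exact: (chart_open chart_U). Qed.

Lemma measurable_chart j : measurable_fun D (fun z => theta (rowT z) 0 j).
Proof.
apply: (measurable_fun_rowT (f := fun u => theta u 0 j) (chart_open chart_U)).
move=> u Ou; apply: (@continuous_comp _ _ _ theta (fun v => v 0 j)).
  by have [ctheta _] := chart_C2 chart_U; exact: ctheta.
exact: coord_continuous.
Qed.

Lemma measurable_tangent_mx i j :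
  measurable_fun D (fun z => tangent_mx theta (rowT z) i j).
Proof.
apply: (measurable_fun_rowT (f := fun u => tangent_mx theta u i j)
  (chart_open chart_U)).
rewrite (_ : (fun _ => _) = fun u => 'D_(delta_mx 0 i) theta u 0 j); last first.
  by apply/funext => u; rewrite mxE.
move=> u Ou.
apply: (@continuous_comp _ _ _ (fun u => 'D_(delta_mx 0 i) theta u)
  (fun v => v 0 j)).
  by have [_ /(_ i)[_ [cD _]]] := chart_C2 chart_U; exact: cD.
exact: coord_continuous.
Qed.

Lemma measurable_vertical i j :
  measurable_fun D (fun z => vertical (theta (rowT z)) i j).
Proof.
under eq_fun do rewrite mxE /Xfield.
case: fintype.split => k; under eq_fun do rewrite !mxE.
  apply: measurable_funB; first exact: measurable_cst.
  do 2![apply: measurable_funM; last exact: measurable_cst].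
  exact: measurable_chart.
apply: measurable_funD; first exact: measurable_cst.
do 2![apply: measurable_funM; last exact: measurable_cst].
exact: measurable_chart.
Qed.

(** Jacobian determinant of the chart projected to the [(x, y)] coordinates. *)
Definition horizontal_minor u : R := \det (lsubmx (tangent_mx theta u)).

(* the limit of [sqrt eps * sqrt (det (first_fundamental_form eps theta u))] as
   [eps] tends to 0 *)
Definition limit_density u : R := Num.sqrt (\sum_i
  (\adj (lsubmx (tangent_mx theta u)) *m contact (theta u) (tangent_mx theta u)) i 0
  ^+ 2).

Lemma measurable_lsub_tangent_mx i j :
  measurable_fun D (fun z => lsubmx (tangent_mx theta (rowT z)) i j).
Proof. by under eq_fun do rewrite mxE; exact: measurable_tangent_mx. Qed.

Lemma measurable_horizontal_minor :
  measurable_fun D (fun z => horizontal_minor (rowT z)).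
Proof. by apply: measurable_fun_det; exact: measurable_lsub_tangent_mx. Qed.

Lemma measurable_limit_density :
  measurable_fun D (fun z => limit_density (rowT z)).
Proof.
apply: measurable_fun_sqrt; apply: measurable_sum => i.
apply: measurable_funX; apply: measurable_fun_mulmx => {}i j.
  by apply: measurable_fun_adj; exact: measurable_lsub_tangent_mx.
rewrite /contact; under eq_fun do rewrite mxE [X in _ + X]mxE.
apply: measurable_funB.
  by under eq_fun do rewrite mxE; exact: measurable_tangent_mx.
apply: measurable_fun_mulmx; first exact: measurable_lsub_tangent_mx.
exact: measurable_vertical.
Qed.

Definition area_density (eps : R) u : R :=
  Num.sqrt (\det (first_fundamental_form eps theta u)).

(** The factor [Num.sqrt eps] clears the [eps^-1] of [det_gram], leaving an expression that is
    regular at [eps = 0]. *)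
Lemma area_densityE eps u : 0 < eps -> Num.sqrt eps * area_density eps u =
  Num.sqrt (eps * horizontal_minor u ^+ 2 + limit_density u ^+ 2).
Proof.
move=> eps0; rewrite -sqrtrM ?ltW// det_gram// mulrDr mulVKf ?gt_eqF//.
by rewrite sqr_sqrtr// sumr_ge0// => i _; exact: sqr_ge0.
Qed.

Lemma limit_density_ge0 u : 0 <= limit_density u.
Proof. exact: sqrtr_ge0. Qed.

Lemma area_density_ge0 eps u : 0 <= area_density eps u.
Proof. exact: sqrtr_ge0. Qed.

Lemma limit_density_le_area eps u : 0 < eps ->
  limit_density u <= Num.sqrt eps * area_density eps u.
Proof.
move=> eps0; rewrite area_densityE// -[leLHS]ger0_norm ?limit_density_ge0//.
by rewrite -sqrtr_sqr ler_wsqrtr// lerDr mulr_ge0 ?sqr_ge0// ltW.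
Qed.

(** The error term is [Num.sqrt eps] times a density free of [eps], so its integral can be
    controlled by the area for [eps = 1]. *)
Lemma area_density_le eps u : 0 < eps ->
  Num.sqrt eps * area_density eps u <=
  limit_density u + Num.sqrt eps * area_density 1 u.
Proof.
move=> eps0; have := area_densityE u (@ltr01 R).
rewrite sqrtr1 !mul1r area_densityE// => ->.
have L0 := limit_density_ge0 u; have s0 := sqrtr_ge0 eps.
set d := horizontal_minor u; set l := limit_density u in L0 *.
have dle : `|d| <= Num.sqrt (d ^+ 2 + l ^+ 2).
  by rewrite -sqrtr_sqr ler_wsqrtr// lerDl sqr_ge0.
apply: (@le_trans _ _ (l + Num.sqrt eps * `|d|)); last first.
  by rewrite lerD2l ler_wpM2l.
have r0 : 0 <= l + Num.sqrt eps * `|d| by rewrite addr_ge0// mulr_ge0.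
(* After squaring, the two sides differ by the nonnegative cross term. *)
rewrite -[leRHS]ger0_norm// -sqrtr_sqr ler_wsqrtr// sqrrD exprMn.
rewrite (sqr_sqrtr (ltW eps0)).
rewrite real_normK ?num_real// addrAC [leLHS]addrC lerDl.
by rewrite mulrn_wge0// !mulr_ge0.
Qed.

Lemma measurable_area_density eps : 0 < eps ->
  measurable_fun D (fun z => area_density eps (rowT z)).
Proof.
move=> eps0; have s0 : Num.sqrt eps != 0 by rewrite gt_eqF// sqrtr_gt0.
(* This form of the density involves no inverse of the frame. *)
under eq_fun do rewrite -[area_density _ _](mulKf s0) area_densityE//.
apply: measurable_funM; first exact: measurable_cst.
apply: measurable_fun_sqrt; apply: measurable_funD.
  apply: measurable_funM; first exact: measurable_cst.
  by apply: measurable_funX; exact: measurable_horizontal_minor.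
by apply: measurable_funX; exact: measurable_limit_density.
Qed.

Lemma surface_areaE eps : surface_area eps Omega theta =
  (\int[lebesgue_measureT R (n + n)]_(z in D) (area_density eps (rowT z))%:E)%E.
Proof. by apply: eq_integral => z _; rewrite mul1r. Qed.

(** The integrands agree pointwise by [horizontal_norm_det_gram], as the rows of the tangent matrix
    are tangent to [S]. *)
Lemma H_perimeterE (N : 'rV[R]_(n + n + 1) -> 'rV[R]_(n + n + 1)) :
  normal_field S N -> H_perimeter N Omega theta =
  (\int[lebesgue_measureT R (n + n)]_(z in D) (limit_density (rowT z))%:E)%E.
Proof.
move=> normal_N; apply: eq_integral => z; rewrite inE /= => Oz; congr EFin.
have Sz : S (theta (rowT z)).
  by apply: (chart_sub chart_U); rewrite -(chart_image chart_U); exists (rowT z).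
have [Nz0 NT] := normal_N _ Sz.
by apply: horizontal_norm_det_gram => // k; exact/NT/chart_tangent.
Qed.

Lemma scaled_surface_area (eps : R) (q : 'rV[R]_(n + n + 1)) : 0 < eps ->
  (surface_area eps Omega theta / (Num.sqrt (\det (metric eps q)))%:E)%E =
  (\int[lebesgue_measureT R (n + n)]_(z in D)
    (Num.sqrt eps * area_density eps (rowT z))%:E)%E.
Proof.
move=> eps0; rewrite det_metric// sqrtrV ?ltW// inver invr_eq0 gt_eqF ?sqrtr_gt0//.
rewrite invrK muleC surface_areaE -ge0_integralZl_EFin ?sqrtr_ge0//.
- exact: measurable_chart_domain.
- by move=> z _; rewrite lee_fin area_density_ge0.
- by apply/measurable_EFinP; exact: measurable_area_density.
Qed.

End ChartTheory.

(** * Passage to the limit by squeezing *)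

Theorem theorem8p5 (R : realType) (n : nat) (n_gt0 : (0 < n)%N)
    (S : set 'rV[R]_(n + n + 1)) (N : 'rV[R]_(n + n + 1) -> 'rV[R]_(n + n + 1))
    (C2_S : C2_hypersurface S) (normal_N : normal_field S N)
    (Sigma0 : characteristic_set S N = set0)
    (U : set 'rV[R]_(n + n + 1)) (Omega : set 'rV[R]_(n + n))
    (theta : 'rV[R]_(n + n) -> 'rV[R]_(n + n + 1))
    (chart_U : chart S U Omega theta) (bounded_U : bounded_set U)
    (finite_U : (surface_area 1 Omega theta < +oo)%E)
    (q : 'rV[R]_(n + n + 1)) :
  (surface_area eps Omega theta / (Num.sqrt (\det (metric eps q)))%:E)%E
    @[eps --> 0^'+] --> H_perimeter N Omega theta.
Proof.
have mD := measurable_chart_domain chart_U.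
have ml := measurable_limit_density chart_U.
have ma := measurable_area_density chart_U.
rewrite (H_perimeterE chart_U normal_N).
set L := (X in _ --> X).
have L_le eps : 0 < eps -> (L <= \int[lebesgue_measureT R (n + n)]_(z in
    rowT @^-1` Omega) (Num.sqrt eps * area_density theta eps (rowT z))%:E)%E.
  move=> eps0; apply: ge0_le_integral => //.
  - by move=> z _; rewrite lee_fin limit_density_ge0.
  - exact/measurable_EFinP.
  - by apply/measurable_EFinP/measurable_funM => //; exact: ma.
  - by move=> z _; rewrite lee_fin limit_density_le_area.
have A_fin : surface_area 1 Omega theta \is a fin_num.
  rewrite ge0_fin_numE// surface_areaE integral_ge0// => z _.
  by rewrite lee_fin area_density_ge0.
(* The lower bound at [eps = 1] compares [L] with the finite area [surface_area 1]. *)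
have L_fin : L \is a fin_num.
  rewrite ge0_fin_numE ?integral_ge0// => [|z _]; last first.
    by rewrite lee_fin limit_density_ge0.
  apply: (le_lt_trans (L_le 1 ltr01)); rewrite surface_areaE in finite_U.
  by under eq_integral do rewrite sqrtr1 mul1r.
(* Both quantities in the upper bound are finite, so it is taken real-valued and its limit is
   computed in [R]. *)
apply: (@squeeze_cvge _ _ _ _ (cst L) _
  (fun eps => (fine L + Num.sqrt eps * fine (surface_area 1 Omega theta))%:E)).
- near=> eps; have eps0 : 0 < eps by near: eps; exact: nbhs_right_gt.
  rewrite (scaled_surface_area chart_U)// L_le//=.
  rewrite EFinD EFinM !fineK// surface_areaE -ge0_integralZl_EFin//; last 2 first.
  + by move=> z _; rewrite lee_fin area_density_ge0.
  + by apply/measurable_EFinP; exact: ma.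
  rewrite /L -ge0_integralD//; last 4 first.
  + by move=> z _; rewrite lee_fin limit_density_ge0.
  + exact/measurable_EFinP.
  + by move=> z _; rewrite -EFinM lee_fin mulr_ge0 ?sqrtr_ge0.
  + by apply: measurable_funeM; apply/measurable_EFinP; exact: ma.
  apply: ge0_le_integral => //.
  + by move=> z _; rewrite lee_fin mulr_ge0 ?sqrtr_ge0.
  + by apply/measurable_EFinP/measurable_funM => //; exact: ma.
  + apply: emeasurable_funD; first exact/measurable_EFinP.
    by apply: measurable_funeM; apply/measurable_EFinP; exact: ma.
  + by move=> z _; rewrite -EFinM -EFinD lee_fin area_density_le.
- exact: cvg_cst.
- rewrite -[L in _ --> L]fineK//; apply: cvg_EFin; first exact: nearW.
  exact: cvg_sqrt_affine.
Unshelve. all: by end_near.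
Qed.
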